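(* Let $X$ be a Cantor set and $\sigma$ a homeomorphism of $X$ such that $(X,\sigma)$ has the lifting property. Then for any non-principal ultrafilter $\mathcal{U}$ on $\mathbb{N}$, the ultrapower $(C(X),\sigma)^{\mathcal{U}}$ is of the form $(C(Y),\tau)$ for a compact Hausdorff space $Y$ and homeomorphism $\tau$ of $Y$ such that $(Y,\tau)$ does not have the lifting property (in its partition-refinement formulation).
   Context: $\mathcal{L}$ is the language of unital C*-algebras (continuous logic) expanded by a unary function symbol $\sigma$; a compact space $X$ with a homeomorphism $S$ corresponds to $(C(X),\sigma)$, $\sigma(f)=f\circ S$, and by Gel'fand duality every commutative unital C*-algebra with an automorphism arises this way. Spirals: for $n\ge1$ let $S_n=L_n\cup M_n\cup\tilde R_n$ with $L_n=\{l\}\times\{0,\dots,n!-1\}$, $\tilde R_n=\{r\}\times\{0,\dots,n!-1\}$, $M_n=\{m\}\times\{-n+1,\dots,n-1\}$, and relation $R_n$: $(l,k)R_n(l,k+1)$, $(r,k)R_n(r,k+1)$ for $0\le k<n!-1$; $(l,n!-1)R_n(l,0)$; $(r,n!-1)R_n(r,0)$; $(m,k)R_n(m,k+1)$ for $-n+1\le k<n-1$; $(l,0)R_n(m,-n+1)$; $(m,n-1)R_n(r,0)$. Maps $S_{n+1}\to S_n$: $\xi_L(a,k)=(l,k\bmod n!)$, $\xi_G(a,k)=(r,k\bmod n!)$, $\xi_M(a,k)=(a,k\bmod n!)$ for $a\in\{l,r\}$, $\xi_M(m,k)=(m,k)$ for $|k|\le n-1$, $\xi_M(m,-n)=(l,0)$,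 $\xi_M(m,n)=(r,0)$. $W_n$ is the disjoint union of $6^n$ copies of $S_n$ indexed by words of length $n$ over $\{L_1,L_2,M_1,M_2,G_1,G_2\}$ (discrete topology, $R_n$ the union of the relations); $\xi:W_{n+1}\to W_n$ maps the copy indexed by $wa$ to the copy indexed by $w$ via $\xi_L,\xi_M,\xi_G$ according as $a\in\{L_1,L_2\},\{M_1,M_2\},\{G_1,G_2\}$; composites give $\xi:W_{n+k}\to W_n$. $\phi:(X,\sigma)\to(W_n,R_n)$ means a continuous surjection $X\to W_n$ with $\phi(x)R_n\phi(\sigma x)$ for all $x$; $A_\phi$ is the partition of $X$ into fibres of $\phi$. For metric $X$, the lifting property means: for every $\epsilon>0$, $n$, and $\phi:(X,\sigma)\to(W_n,R_n)$ there are $k\ge1$ and $\psi:(X,\sigma)\to(W_{n+k},R_{n+k})$ with all members of $A_\psi$ of diameter $<\epsilon$ and $\phi=\xi\circ\psi$. Partition-refinement formulation (equivalent for Cantor sets, and used for general compact $Y$): for every $n$, every $\phi:(Y,\tau)\to(W_n,R_n)$ and every clopen partition $A$ refining $A_\phi$, there are $k\ge1$ and $\psi:(Y,\tau)\to(W_{n+k},R_{n+k})$ with $A_\psi$ refining $A$ and $\phi=\xi\circ\psi$.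
   Formalization: Assumes some φ:(X,σ)→(W_n,R_n), n≥1, exists (else lifting is vacuous for X and Y, e.g. an odometer); besides the printed formulas, under which ξ is no morphism, also covers attaching M_n at (l,−n mod n!), (r,n mod n!), likewise in ξ_M. *)

(* Defs.v *)
From HB Require Import structures.
From mathcomp Require Import all_boot all_order all_algebra.
From mathcomp Require Import complex.
From mathcomp Require Import all_classical all_reals all_analysis.

Set Implicit Arguments.
Unset Strict Implicit.
Unset Printing Implicit Defensive.

Import Order.TTheory GRing.Theory Num.Theory.
Import numFieldNormedType.Exports.

Local Open Scope classical_set_scope.
Local Open Scope ring_scope.
Local Open Scope complex_scope.
Local Open Scope quotient_scope.

Import Normc.

Definition cantor_set (X : topologicalType) : Prop :=
  cantor_like X /\ [set: X] !=set0.

Definition homeomorphism (X : topologicalType) (s : continuousType X X) : Prop :=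
  exists t : continuousType X X, cancel s t /\ cancel t s.

(* The language of unital C*-algebras with one more unary symbol [Lsigma]. The
   constant 0, the inverse x |-> -x and the distance are terms in the others:
   0 = 0 *: 1, - x = (-1) *: x and d(x, y) = norm (x - y). *)
Record Lstructure (R : realType) := MkLstructure {
  Lsort :> Type ;
  Lone : Lsort ;
  Ladd : Lsort -> Lsort -> Lsort ;
  Lmul : Lsort -> Lsort -> Lsort ;
  Lscale : R[i] -> Lsort -> Lsort ;
  Lstar : Lsort -> Lsort ;
  Lnorm : Lsort -> R ;
  Lsigma : Lsort -> Lsort
}.

Definition Lisomorphic (R : realType) (A B : Lstructure R) : Prop :=
  exists F : A -> B,
    bijective F /\
    F (Lone A) = Lone B /\
    (forall x y, F (Ladd x y) = Ladd (F x) (F y)) /\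
    (forall x y, F (Lmul x y) = Lmul (F x) (F y)) /\
    (forall c x, F (Lscale c x) = Lscale c (F x)) /\
    (forall x, F (Lstar x) = Lstar (F x)) /\
    (forall x, Lnorm (F x) = Lnorm x) /\
    (forall x, F (Lsigma x) = Lsigma (F x)).

Notation C R X := (continuousType X (R[i]^o)).

Section ContinuousFunctions.
Context {R : realType} {X : topologicalType}.
Implicit Types (f g : C R X) (c : R[i]).

Lemma normc_eq (z : R[i]) : `|z| = (normc z)%:C.
Proof. by rewrite normc_def; case: z. Qed.

Lemma cfun_add_cts f g : continuous ((f : X -> R[i]^o) \+ g).
Proof. by move=> x; apply: cvgD; exact: cts_fun. Qed.

Lemma cfun_mul_cts f g : continuous ((f : X -> R[i]^o) \* g).
Proof. by move=> x; apply: cvgM; exact: cts_fun. Qed.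

Lemma cfun_scale_cts c f : continuous (fun x => c * f x : R[i]^o).
Proof. by move=> x; apply: cvgM; [exact: cvg_cst|exact: cts_fun]. Qed.

Lemma cfun_star_cts f : continuous (fun x => conjc (f x) : R[i]^o).
Proof.
move=> x; apply/cvgrPdist_lt => e e0.
have /cvgrPdist_lt/(_ e e0) := @cts_fun _ _ f x.
by apply: filterS => y; rewrite -rmorphB/= normcJ.
Qed.

Definition cfun_one : C R X := cst (1 : R[i]^o).
Definition cfun_add f g : C R X := mkcts (@cfun_add_cts f g).
Definition cfun_mul f g : C R X := mkcts (@cfun_mul_cts f g).
Definition cfun_scale c f : C R X := mkcts (@cfun_scale_cts c f).
Definition cfun_star f : C R X := mkcts (@cfun_star_cts f).
Definition cfun_comp f (s : continuousType X X) : C R X := f \o s.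
Definition cfun_sub f g : C R X := cfun_add f (cfun_scale (-1) g).

Definition supnorm f : R := sup (range (fun x => normc (f x))).

Lemma normc_ge0 (z : R[i]) : 0 <= normc z.
Proof. by case: z => a b; exact: sqrtr_ge0. Qed.

Lemma normc_le_supnorm f (M : R) (x : X) :
  (forall x, normc (f x) <= M) -> normc (f x) <= supnorm f.
Proof.
move=> fM; apply: ub_le_sup; last by exists x.
by exists M => _ [y _ <-].
Qed.

Lemma supnorm_le f (M : R) :
  0 <= M -> (forall x, normc (f x) <= M) -> supnorm f <= M.
Proof.
move=> M0 fM; rewrite /supnorm.
have [->|/set0P A0] := eqVneq (range (fun x => normc (f x))) set0.
  by rewrite sup0.
by apply: ge_sup => // _ [y _ <-].
Qed.

Lemma supnorm_ge0 f : 0 <= supnorm f.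
Proof.
rewrite /supnorm; set A := (A in sup A).
have [[[_ [x _ _]] Ab]|/sup_out->//] := pselect (has_sup A).
by rewrite (le_trans (normc_ge0 (f x)))//; apply: ub_le_sup => //; exists x.
Qed.

End ContinuousFunctions.

Definition C_struct (R : realType) (X : topologicalType)
    (s : continuousType X X) : Lstructure R :=
  {| Lsort := C R X ; Lone := cfun_one ; Ladd := cfun_add ; Lmul := cfun_mul ;
     Lscale := cfun_scale ; Lstar := cfun_star ; Lnorm := supnorm ;
     Lsigma := fun f => cfun_comp f s |}.

(* The ultrapower of (C(X), s) is the algebra of bounded sequences in C(X),
   modulo the sequences whose norms tend to 0 along U. The bound is uniform in
   n and x, so that the sequences form an algebra for every X; for compact X it
   is a bound on the norms. *)
Record bseq_C (R : realType) (X : topologicalType) := BseqC {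
  bseq_fun :> nat -> C R X ;
  bseq_bounded : exists M : R, forall n x, normc (bseq_fun n x) <= M
}.

HB.instance Definition _ (R : realType) (X : topologicalType) :=
  gen_eqMixin (bseq_C R X).
HB.instance Definition _ (R : realType) (X : topologicalType) :=
  gen_choiceMixin (bseq_C R X).

Section BoundedSequences.
Context {R : realType} {X : topologicalType}.
Implicit Types (f g : bseq_C R X).

Lemma bseq_one_bd : exists M : R,
  forall (n : nat) (x : X), normc ((fun=> cfun_one) n x : R[i]) <= M.
Proof. by exists (normc 1) => n x; exact: lexx. Qed.
Definition bseq_one : bseq_C R X := BseqC bseq_one_bd.

Lemma bseq_add_bd f g : exists M : R,
  forall n x, normc (cfun_add (f n) (g n) x) <= M.
Proof.
case: (bseq_bounded f) (bseq_bounded g) => M fM [N gN]; exists (M + N) => n x.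
by rewrite (le_trans (le_normcD _ _))// lerD.
Qed.
Definition bseq_add f g : bseq_C R X := BseqC (@bseq_add_bd f g).

Lemma bseq_mul_bd f g : exists M : R,
  forall n x, normc (cfun_mul (f n) (g n) x) <= M.
Proof.
case: (bseq_bounded f) (bseq_bounded g) => M fM [N gN]; exists (M * N) => n x.
by rewrite /= normcM ler_pM// normc_ge0.
Qed.
Definition bseq_mul f g : bseq_C R X := BseqC (@bseq_mul_bd f g).

Lemma bseq_scale_bd (c : R[i]) f : exists M : R,
  forall n x, normc (cfun_scale c (f n) x) <= M.
Proof.
case: (bseq_bounded f) => M fM; exists (normc c * M) => n x.
by rewrite /= normcM ler_wpM2l// normc_ge0.
Qed.
Definition bseq_scale (c : R[i]) f : bseq_C R X := BseqC (@bseq_scale_bd c f).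

Lemma normc_conjc (z : R[i]) : normc (conjc z) = normc z.
Proof. by case: z => a b /=; rewrite sqrrN. Qed.

Lemma bseq_star_bd f : exists M : R,
  forall n x, normc (cfun_star (f n) x) <= M.
Proof.
by case: (bseq_bounded f) => M fM; exists M => n x; rewrite /= normc_conjc.
Qed.
Definition bseq_star f : bseq_C R X := BseqC (@bseq_star_bd f).

Lemma bseq_sigma_bd (s : continuousType X X) f : exists M : R,
  forall n x, normc (cfun_comp (f n) s x) <= M.
Proof. by case: (bseq_bounded f) => M fM; exists M => n x; exact: fM. Qed.
Definition bseq_sigma (s : continuousType X X) f : bseq_C R X :=
  BseqC (@bseq_sigma_bd s f).

End BoundedSequences.

Section Ultrapower.
Context {R : realType} {X : topologicalType}.
Variables (U : set_system nat) (UU : UltraFilter U).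
Implicit Types (f g h : bseq_C R X).

Definition ultra_eqv f g : bool :=
  `[< (fun n => supnorm (cfun_sub (f n) (g n))) @ U --> (0 : R) >].

Lemma ultra_eqvP f g : reflect
  (forall e : R, 0 < e ->
     \forall n \near U, forall x, normc (f n x - g n x) <= e)
  (ultra_eqv f g).
Proof.
have FU : Filter U by typeclasses eauto.
have fgE n x : cfun_sub (f n) (g n) x = f n x - g n x.
  by rewrite -(mulN1r (g n x : R[i])).
rewrite /ultra_eqv; apply: (iffP (asboolP _)) => [fg e e0|fg].
  have /cvgrPdist_le/(_ e e0) := fg.
  apply: filterS => n; rewrite sub0r normrN ger0_norm ?supnorm_ge0// => fge x.
  rewrite -fgE (le_trans _ fge)//.
  have [M] := bseq_bounded (bseq_add f (bseq_scale (-1) g)).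
  by move=> fgM; apply: (@normc_le_supnorm _ _ _ M) => y; exact: (fgM n y).
apply/cvgrPdist_le => e e0; apply: filterS (fg e e0) => n fge.
rewrite sub0r normrN ger0_norm ?supnorm_ge0//.
by apply: supnorm_le => [|x]; [exact: ltW|rewrite fgE].
Qed.

Lemma normcB (z w : R[i]) : normc (z - w) = normc (w - z).
Proof. by rewrite -normcN opprB. Qed.

Lemma ultra_eqv_refl : reflexive ultra_eqv.
Proof.
have FU : Filter U by typeclasses eauto.
move=> f; apply/ultra_eqvP => e e0; apply: filterE => n x.
by rewrite subrr normc0 ltW.
Qed.

Lemma ultra_eqv_sym : symmetric ultra_eqv.
Proof.
have FU : Filter U by typeclasses eauto.
move=> f g; apply/ultra_eqvP/ultra_eqvP => fg e e0;
  by apply: filterS (fg e e0) => n + x => /(_ x); rewrite normcB.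
Qed.

Lemma ultra_eqv_trans : transitive ultra_eqv.
Proof.
have FU : Filter U by typeclasses eauto.
move=> g f h /ultra_eqvP fg /ultra_eqvP gh; apply/ultra_eqvP => e e0.
have e20 : 0 < e / 2 by rewrite divr_gt0.
apply: filterS2 (fg _ e20) (gh _ e20) => n fgn ghn x.
rewrite -(subrKA (g n x)) (le_trans (le_normcD _ _))//.
by rewrite [leRHS]splitr lerD.
Qed.

Canonical ultra_equiv := EquivRel ultra_eqv
  ultra_eqv_refl ultra_eqv_sym ultra_eqv_trans.

Definition ultra_sort : Type := {eq_quot ultra_equiv}.
Implicit Types (p q : {eq_quot ultra_equiv}).

Definition ultra_class f : {eq_quot ultra_equiv} := \pi_{eq_quot ultra_equiv} f.

Definition ultra_add p q := ultra_class (bseq_add (repr p) (repr q)).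
Definition ultra_mul p q := ultra_class (bseq_mul (repr p) (repr q)).
Definition ultra_scale (c : R[i]) p := ultra_class (bseq_scale c (repr p)).
Definition ultra_star p := ultra_class (bseq_star (repr p)).
Definition ultra_sigma (s : continuousType X X) p :=
  ultra_class (bseq_sigma s (repr p)).
Definition ultra_norm p : R := lim ((fun n => supnorm (repr p n)) @ U).

Lemma ultra_classP f g : ultra_class f = ultra_class g <-> ultra_eqv f g.
Proof. by split=> [/eqmodP|?]; [|apply/eqmodP]. Qed.

Lemma ultra_eqv_repr f : ultra_eqv (repr (ultra_class f)) f.
Proof. by apply/ultra_classP; rewrite /ultra_class reprK. Qed.

Lemma ultra_addE f g :
  ultra_add (ultra_class f) (ultra_class g) = ultra_class (bseq_add f g).
Proof.
have FU : Filter U by typeclasses eauto.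
apply/ultra_classP/ultra_eqvP => e e0.
have e20 : 0 < e / 2 by rewrite divr_gt0.
have /ultra_eqvP/(_ _ e20) := ultra_eqv_repr f.
have /ultra_eqvP/(_ _ e20) := ultra_eqv_repr g.
apply: filterS2 => n gn fn x.
rewrite /= opprD addrACA (le_trans (le_normcD _ _))//.
by rewrite [leRHS]splitr lerD.
Qed.

Lemma ultra_mulE f g :
  ultra_mul (ultra_class f) (ultra_class g) = ultra_class (bseq_mul f g).
Proof.
have FU : Filter U by typeclasses eauto.
apply/ultra_classP/ultra_eqvP => e e0.
set f' := repr _; set g' := repr _.
have [M f'M] := bseq_bounded f'; have [N gN] := bseq_bounded g.
pose K := Num.max 1 (Num.max M N).
have K0 : 0 < K by rewrite lt_max ltr01.
have MK : M <= K by rewrite !le_max lexx orbT.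
have NK : N <= K by rewrite !le_max lexx !orbT.
have eK : 0 < e / 2 / K by rewrite !divr_gt0.
have /ultra_eqvP/(_ _ eK) := ultra_eqv_repr f.
have /ultra_eqvP/(_ _ eK) := ultra_eqv_repr g.
apply: filterS2 => n gn fn x /=.
rewrite -(subrKA (f' n x * g n x)) -mulrBr -mulrBl.
rewrite (le_trans (le_normcD _ _))// !normcM [leRHS]splitr lerD//.
  rewrite -[leRHS](@divfK _ K) ?gt_eqF// mulrC ler_pM// ?normc_ge0//.
  exact: (le_trans (f'M n x)).
rewrite -[leRHS](@divfK _ K) ?gt_eqF// ler_pM// ?normc_ge0//.
exact: (le_trans (gN n x)).
Qed.

Lemma ultra_scaleE (c : R[i]) f :
  ultra_scale c (ultra_class f) = ultra_class (bseq_scale c f).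
Proof.
have FU : Filter U by typeclasses eauto.
apply/ultra_classP/ultra_eqvP => e e0.
have K0 : 0 < normc c + 1 by rewrite ltr_wpDl// normc_ge0.
have /ultra_eqvP/(_ _ (divr_gt0 e0 K0)) := ultra_eqv_repr f.
apply: filterS => n fn x; rewrite /= -mulrBr normcM.
rewrite -[leRHS](@divfK _ (normc c + 1)) ?gt_eqF// [leRHS]mulrC.
by rewrite ler_pM// ?normc_ge0// lerDl.
Qed.

Lemma ultra_starE f : ultra_star (ultra_class f) = ultra_class (bseq_star f).
Proof.
have FU : Filter U by typeclasses eauto.
apply/ultra_classP/ultra_eqvP => e e0.
have /ultra_eqvP/(_ _ e0) := ultra_eqv_repr f.
by apply: filterS => n fn x; rewrite /= -rmorphB normc_conjc.
Qed.

Lemma ultra_sigmaE (s : continuousType X X) f :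
  ultra_sigma s (ultra_class f) = ultra_class (bseq_sigma s f).
Proof.
have FU : Filter U by typeclasses eauto.
apply/ultra_classP/ultra_eqvP => e e0.
have /ultra_eqvP/(_ _ e0) := ultra_eqv_repr f.
by apply: filterS => n fn x; exact: fn.
Qed.

Definition ultrapower_C (s : continuousType X X) : Lstructure R :=
  {| Lsort := ultra_sort ; Lone := ultra_class bseq_one ; Ladd := ultra_add ;
     Lmul := ultra_mul ; Lscale := ultra_scale ; Lstar := ultra_star ;
     Lnorm := ultra_norm ; Lsigma := ultra_sigma s |}.

End Ultrapower.

Definition nonprincipal (U : set_system nat) : Prop :=
  forall n, U <> principal_filter n.

Inductive arm := arm_l | arm_m | arm_r.
HB.instance Definition _ := gen_eqMixin arm.
HB.instance Definition _ := gen_choiceMixin arm.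

Inductive letter := L1 | L2 | M1 | M2 | G1 | G2.
HB.instance Definition _ := gen_eqMixin letter.
HB.instance Definition _ := gen_choiceMixin letter.

(* The points (l, att_l n) and (r, att_r n) of S_n at which the middle arm is
   attached, which are also the images of (m, -n) and (m, n) under xi_M. In the
   printed definition both att_l n and att_r n are 0. With it, for n > 1, the
   maps xi do not send R_(n+1) to R_n: (l, 0) R_(n+1) (m, -n), but both points
   go to (l, 0) under xi_M, and (l, 0) R_n (l, 0) fails. The maps xi are
   morphisms of relations when att_l n and att_r n continue the numbering of the
   middle arm, that is, are -n and n modulo n!. The two agree for n = 1, 2. *)
Variant attachment := printed | coherent.

Definition att_l (c : attachment) (n : nat) : int :=
  match c with printed => 0 | coherent => ((- n%:Z) %% n`!%:Z)%Z end.

Definition att_r (c : attachment) (n : nat) : int :=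
  match c with printed => 0 | coherent => (n%:Z %% n`!%:Z)%Z end.

(* S_n, for 0 < n, is a subset of the points (a, k); only n > 0 is used. *)
Definition spt : Type := (arm * int)%type.

Definition spiral (n : nat) : set spt := [set p |
  match p.1 with
  | arm_m => (- n%:Z + 1 <= p.2) && (p.2 <= n%:Z - 1)
  | _ => (0 <= p.2) && (p.2 < n`!%:Z)
  end].

Definition spiral_rel (c : attachment) (n : nat) (p q : spt) : Prop :=
  match p.1, q.1 with
  | arm_l, arm_l | arm_r, arm_r =>
      q.2 = p.2 + 1 \/ p.2 = n`!%:Z - 1 /\ q.2 = 0
  | arm_m, arm_m => q.2 = p.2 + 1
  | arm_l, arm_m => p.2 = att_l c n /\ q.2 = - n%:Z + 1
  | arm_m, arm_r => p.2 = n%:Z - 1 /\ q.2 = att_r c n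
  | _, _ => False
  end.

Definition xi_L (n : nat) (p : spt) : spt := (arm_l, (p.2 %% n`!%:Z)%Z).

Definition xi_G (n : nat) (p : spt) : spt := (arm_r, (p.2 %% n`!%:Z)%Z).

Definition xi_M (c : attachment) (n : nat) (p : spt) : spt :=
  match p.1 with
  | arm_m => if p.2 == - n%:Z then (arm_l, att_l c n)
             else if p.2 == n%:Z then (arm_r, att_r c n) else p
  | a => (a, (p.2 %% n`!%:Z)%Z)
  end.

Definition xi_letter (c : attachment) (n : nat) (a : letter) : spt -> spt :=
  match a with
  | L1 | L2 => xi_L n
  | M1 | M2 => xi_M c n
  | G1 | G2 => xi_G n
  end.

(* All W_n live in one discrete space of pairs (word, point of a spiral). *)
Definition Wpt : Type := discrete_topology (seq letter * spt)%type.

Definition W (n : nat) : set Wpt :=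
  [set u : Wpt | size u.1 = n /\ spiral n u.2].

Definition W_rel (c : attachment) (n : nat) (u v : Wpt) : Prop :=
  u.1 = v.1 /\ spiral_rel c n u.2 v.2.

(* On W_(n+1) the word of u is [rcons w a] with [size w = n], so that
   [take n] gives w and [nth _ _ n] gives a; the default L1 is not reached. *)
Definition xi (c : attachment) (n : nat) (u : Wpt) : Wpt :=
  (take n u.1, xi_letter c n (nth L1 u.1 n) u.2).

(* The composite W_(n+k) -> W_n. *)
Fixpoint xi_comp (c : attachment) (n k : nat) : Wpt -> Wpt :=
  match k with
  | 0%N => id
  | k'.+1 => xi_comp c n k' \o xi c (n + k')
  end.

(* phi : (X, s) -> (W_n, R_n) *)
Definition spiral_map (c : attachment) (X : topologicalType) (s : X -> X)
    (n : nat) (phi : X -> Wpt) : Prop :=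
  [/\ continuous phi, range phi = W n &
      forall x, W_rel c n (phi x) (phi (s x))].

Definition fibre_partition (S T : Type) (f : S -> T) : set (set S) :=
  [set f @^-1` [set y] | y in range f].

Definition clopen_partition (X : topologicalType) (A : set (set X)) : Prop :=
  [/\ forall B, A B -> clopen B /\ B !=set0,
      \bigcup_(B in A) B = [set: X] & trivIset A id].

Definition refines (X : Type) (A B : set (set X)) : Prop :=
  forall a, A a -> exists2 b, B b & a `<=` b.

Definition diameter (R : realType) (X : metricType R) (B : set X) : \bar R :=
  ereal_sup [set (mdist x y)%:E | x in B & y in B].

Definition lifting_property (c : attachment) (R : realType) (X : metricType R)
    (s : X -> X) : Prop :=
  forall (e : R) (n : nat) (phi : X -> Wpt),
    0 < e -> (0 < n)%N -> spiral_map c s n phi ->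
    exists (k : nat) (psi : X -> Wpt),
      [/\ (1 <= k)%N, spiral_map c s (n + k) psi,
          forall B, fibre_partition psi B -> (diameter B < e%:E)%E &
          phi = xi_comp c n k \o psi].

Definition partition_lifting_property (c : attachment) (Y : topologicalType)
    (t : Y -> Y) : Prop :=
  forall (n : nat) (phi : Y -> Wpt) (A : set (set Y)),
    (0 < n)%N -> spiral_map c t n phi ->
    clopen_partition A -> refines A (fibre_partition phi) ->
    exists (k : nat) (psi : Y -> Wpt),
      [/\ (1 <= k)%N, spiral_map c t (n + k) psi,
          refines (fibre_partition psi) A &
          phi = xi_comp c n k \o psi].

(* Main.v *)
Require Import Defs.
From mathcomp Require Import all_boot all_order all_algebra.
From mathcomp Require Import complex.
From mathcomp Require Import all_classical all_reals all_analysis.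
From HB Require Import structures.
From mathcomp Require Import zify ring lra.

Set Implicit Arguments.
Unset Strict Implicit.
Unset Printing Implicit Defensive.

Import Order.TTheory GRing.Theory Num.Theory.
Import numFieldNormedType.Exports.
Import Normc.

Local Open Scope classical_set_scope.
Local Open Scope ring_scope.
Local Open Scope complex_scope.
Local Open Scope quotient_scope.

(* Y is the space of characters of the ultrapower, a compact Hausdorff space on
   which every continuous function is, up to any e > 0, the evaluation of a
   bounded sequence (patch constants along bump functions over a finite cover),
   hence exactly one (diagonalise along U).

   Some phi : (X, s) -> (W_n, R_n) induces phiY on Y. By the lifting property X
   maps onto spirals with arbitrarily long middle arms, so for each m there are
   a clopen set B_m and a point x_m such that s^i x_m lies in B_m exactly when i
   is a power of two, for all i <= m. The B_m define a clopen set of Y, and the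
   x_m a point y whose whole orbit visits that set exactly at the powers of two.
   If psi : (Y, t) -> (W_(n+k), R_(n+k)) refined the partition given by phiY and
   this set, the orbit of y would follow a path in a single spiral, and such a
   path is eventually periodic with period (n+k)!. *)

(** * Compactness and ideals of sets *)

(** Otherwise the complements of the members of [I] form a proper filter, and none of its cluster
    points has a neighbourhood in [I]. This serves as induction over finite covers. *)
Lemma compact_ideal (T : topologicalType) (I : set (set T)) :
  compact [set: T] -> I set0 ->
  (forall A B, A `<=` B -> I B -> I A) ->
  (forall A B, I A -> I B -> I (A `|` B)) ->
  (forall x : T, exists2 A, nbhs x A & I A) -> I setT.
Proof.
move=> cT I0 IS IU Iloc; apply: contrapT => nIT.
have FF : ProperFilter [set A | I (~` A)].
  split; first by rewrite /= setC0.
  split=> [|A B IA IB|A B AB IA] /=.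
  - by rewrite setCT.
  - by rewrite setCI; exact: IU.
  - by apply: IS IA; exact: subsetC.
have FT : [set A | I (~` A)] [set: T] by rewrite /= setCT.
have [x [_ xF]] := cT _ FF FT.
have [A xA IA] := Iloc x.
have nAF : [set A | I (~` A)] (~` A) by rewrite /= setCK.
by have [y []] := xF _ _ nAF xA.
Qed.

Lemma compact_discrete_range (T : topologicalType) (D : discreteTopologicalType)
    (f : T -> D) :
  compact [set: T] -> continuous f -> finite_set (range f).
Proof.
move=> cT cf.
apply: (@compact_ideal T [set A | finite_set (f @` A)]) => //=.
- by rewrite image_set0.
- by move=> A B AB; apply: sub_finite_set; exact: image_subset.
- by move=> A B fA fB; rewrite image_setU finite_setU.
move=> x; exists (f @^-1` [set f x]).
  by apply: cf; rewrite nbhs_principalE; exact/principal_filterP.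
by apply: (@sub_finite_set _ _ [set f x]) => // _ [y /= <- <-].
Qed.

(** * Complex limits *)

Section ComplexLimits.
Context {R : realType}.
Implicit Types (z w : R[i]) (T : Type).

Lemma normc_distC z w : normc (z - w) = normc (w - z).
Proof. by rewrite -normcN opprB. Qed.

Lemma normc_triangle z w v : normc (z - v) <= normc (z - w) + normc (w - v).
Proof. by rewrite -(subrKA w) (le_trans (le_normcD _ _)). Qed.

Lemma normc_complex (a b : R) : normc (a +i* b) <= `|a| + `|b|.
Proof.
have -> : a +i* b = (a +i* 0) + (0 +i* b) by simpc.
rewrite (le_trans (le_normcD _ _))//=.
by rewrite !expr0n /= addr0 add0r !sqrtr_sqr.
Qed.

Lemma normc_Re z : `|complex.Re z| <= normc z.
Proof.
by case: z => a b /=; rewrite -sqrtr_sqr ler_wsqrtr// lerDl sqr_ge0.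
Qed.

Lemma normc_Im z : `|complex.Im z| <= normc z.
Proof.
by case: z => a b /=; rewrite -sqrtr_sqr ler_wsqrtr// lerDr sqr_ge0.
Qed.

Lemma normc_real (a : R) : normc a%:C = `|a|.
Proof. by rewrite /= expr0n /= addr0 sqrtr_sqr. Qed.

Lemma normc_eq0P z : (forall e : R, 0 < e -> normc z < e) -> z = 0.
Proof.
move=> ze; apply: eq0_normc; apply/eqP; rewrite eq_le normc_ge0 andbT.
by apply/ler_addgt0Pl => e e0; rewrite addr0 ltW// ze.
Qed.

(** Radii for [R[i]^o] are themselves complex; [0 < e] forces a zero imaginary part, so real radii
    suffice. *)
Lemma normc_cvgP T (F : set_system T) (FF : Filter F) (f : T -> R[i]^o)
    (l : R[i]^o) :
  (f @ F --> l) <->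
  (forall e : R, 0 < e -> \forall t \near F, normc (l - f t) < e).
Proof.
split=> [/cvgrPdist_lt fl e e0|fl].
  have e0' : 0 < e%:C by rewrite ltcR.
  apply: filterS (fl _ e0') => t; rewrite normc_eq.
  by rewrite ltcR.
apply/cvgrPdist_lt => e; rewrite ltcE => /andP[/eqP/= e1 e0].
apply: filterS (fl _ e0) => t h.
by rewrite normc_eq ltcE /= e1 eqxx.
Qed.

(** A cluster point in the compact interval is a limit because [V] decides every set. The index type
    is arbitrary since limits are taken along [U] and along ultrafilters on the spectrum. *)
Lemma ultra_real_lim T (V : set_system T) (UV : UltraFilter V) (f : T -> R)
    (M : R) :
  (forall t, `|f t| <= M) ->
  exists l, forall e : R, 0 < e -> \forall t \near V, `|l - f t| < e.
Proof.
move=> fM.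
have fMV : (f @ V) `[- M, M]%classic.
  by apply: (@filterE _ V) => t /=; rewrite in_itv /= -ler_norml; exact: fM.
have [l [_ lV]] := @segment_compact R (- M) M _ _ fMV.
exists l => e e0.
have [//|nV] := in_ultra_setVsetC [set t | `|l - f t| < e] UV.
exfalso; have [_ [[t nt <-] ht]] := lV (f @` [set t | ~ `|l - f t| < e]) _
  (filterS (fun t h => ex_intro2 _ _ t h erefl) nV) (nbhsx_ballx l e e0).
by apply: nt; move: ht; rewrite -ball_normE.
Qed.

Lemma ultra_normc_lim T (V : set_system T) (UV : UltraFilter V) (f : T -> R[i])
    (M : R) :
  (forall t, normc (f t) <= M) ->
  exists l, forall e : R, 0 < e -> \forall t \near V, normc (f t - l) < e.
Proof.
move=> fM; have FV : Filter V by typeclasses eauto.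
have [a fa] := ultra_real_lim UV (fun t => le_trans (normc_Re (f t)) (fM t)).
have [b fb] := ultra_real_lim UV (fun t => le_trans (normc_Im (f t)) (fM t)).
exists (a +i* b) => e e0; have e20 : 0 < e / 2 by rewrite divr_gt0.
apply: filterS2 (fa _ e20) (fb _ e20) => t au bv.
rewrite normc_distC.
have -> : (a +i* b) - f t = (a - complex.Re (f t)) +i* (b - complex.Im (f t)).
  by case: (f t).
apply: le_lt_trans (normc_complex _ _) _.
by rewrite [ltRHS]splitr ltrD.
Qed.

End ComplexLimits.

(** * Complex continuity and bump functions *)

Section ComplexContinuity.
Context {R : realType}.

Lemma nbhs_normcP (a : R[i]^o) (A : set R[i]^o) :
  nbhs a A <-> exists2 d : R, 0 < d & forall z, normc (a - z) < d -> A z.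
Proof.
rewrite -nbhs_ballE; split=> [[e /= e0]|[d d0 dA]].
  rewrite -ball_normE => eA; move: e0; rewrite ltcE /= => /andP[/eqP e1 e0].
  exists (complex.Re e) => // z az; apply: eA; rewrite /ball_ /=.
  by rewrite normc_eq ltcE /= e1 eqxx.
exists d%:C => /=; first by rewrite ltcR.
by rewrite -ball_normE => z /=; rewrite normc_eq ltcR; exact: dA.
Qed.

Lemma normc_cts : continuous (@normc R : R[i]^o -> R).
Proof.
move=> z; apply/(@cvgrPdist_lt _ _ _ _ (nbhs_filter z)) => e e0.
apply/nbhs_normcP; exists e => // w.
apply: le_lt_trans; have := normc_triangle z w 0; have := normc_triangle w z 0.
rewrite !subr0 (normc_distC w z) ler_norml => h1 h2.
by apply/andP; split; lra.
Qed.

Lemma complex_real_cts : continuous (fun t : R => t%:C : R[i]^o).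
Proof.
move=> t; apply/normc_cvgP => e e0.
have /cvgrPdist_lt/(_ e e0) : (id : R -> R) @ nbhs t --> t by exact: cvg_id.
by apply: filterS => u; rewrite -rmorphB normc_real.
Qed.

Lemma conjc_cts : continuous (fun z : R[i]^o => conjc z : R[i]^o).
Proof.
move=> z; apply/(normc_cvgP (nbhs_filter z)) => e e0.
apply/nbhs_normcP; exists e => // w.
by rewrite -rmorphB normc_conjc.
Qed.

(* Equal to 1 on the disc of radius e/2 around a, to 0 outside that of radius
   e. *)
Definition bump (a : R[i]) (e : R) (z : R[i]^o) : R[i]^o :=
  (Order.max 0 (Order.min 1 (2 - normc (z - a) / (e / 2))))%:C.

Lemma bump_cts a e : continuous (bump a e).
Proof.
have lin_cts : continuous (fun z : R[i]^o => 2 - normc (z - a) / (e / 2) : R).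
  move=> z; have FF := nbhs_filter z.
  have cvg1 : (fun w : R[i]^o => w - a : R[i]^o) @ z --> (z - a : R[i]^o).
    apply/normc_cvgP => d d0; apply/nbhs_normcP.
    by exists d => // w; rewrite opprB addrA subrK.
  have cvg2 := cvg_comp _ _ cvg1 (@normc_cts _).
  exact: (cvgB (@cvg_cst _ _ _ _ FF) (cvgM cvg2 (@cvg_cst _ _ _ _ FF))).
have clamp_cts := max_fun_continuous (@cst_continuous R[i]^o R 0)
  (min_fun_continuous (@cst_continuous R[i]^o R 1) lin_cts).
by move=> z; exact: (cvg_comp _ _ (clamp_cts z) (@complex_real_cts _)).
Qed.

Lemma bump_unit a e z : exists2 t : R, 0 <= t <= 1 & bump a e z = t%:C.
Proof.
exists (Order.max 0 (Order.min 1 (2 - normc (z - a) / (e / 2)))) => //.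
by rewrite le_max lexx /= ge_max ler01 /= ge_min lexx.
Qed.

Lemma bump1 a e z : 0 < e -> normc (z - a) < e / 2 -> bump a e z = 1.
Proof.
move=> e0 h; rewrite /bump.
have h' : normc (z - a) / (e / 2) <= 1.
  by rewrite ler_pdivrMr ?divr_gt0// mul1r ltW.
rewrite min_l; last by lra.
by rewrite max_r ?ler01.
Qed.

Lemma bump0 a e z : 0 < e -> e <= normc (z - a) -> bump a e z = 0.
Proof.
move=> e0 h; rewrite /bump.
have h' : 2 <= normc (z - a) / (e / 2).
  by rewrite ler_pdivlMr ?divr_gt0// mulrC divfK ?pnatr_eq0.
by rewrite max_l// ge_min; apply/orP; right; lra.
Qed.

End ComplexContinuity.

(** * The spectrum of the ultrapower *)

Section Ultraspectrum.
Context {R : realType} {X : topologicalType}.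
Variable U : set_system nat.
Implicit Types (f g h : bseq_C R X).

(* The Gelfand spectrum of the ultrapower. A character is a map on bounded
   sequences such that any three of its values are, for U-many n, approximated
   by the values at a common point of X: three, so that the graph of a binary
   operation can be seen. *)
Record ultraspec (UU : UltraFilter U) := Ultraspec {
  ev : bseq_C R X -> R[i] ;
  ev_approx : forall f g h (e : R), 0 < e -> \forall n \near U, exists x,
    [/\ normc (f n x - ev f) < e, normc (g n x - ev g) < e &
        normc (h n x - ev h) < e]
}.

HB.instance Definition _ UU := gen_eqMixin (ultraspec UU).
HB.instance Definition _ UU := gen_choiceMixin (ultraspec UU).

Variable UU : UltraFilter U.
Local Notation Y := (ultraspec UU).

#[local] Instance proper_ultra : ProperFilter U.
Proof. exact: ultra_proper. Qed.

Implicit Types y z : Y.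

Lemma ultraspec_ext y z : ev y =1 ev z -> y = z.
Proof.
case: y z => [a Ha] [b Hb] /= /funext ab.
rewrite ab in Ha *; congr Ultraspec; exact: Prop_irrelevance.
Qed.

Lemma ev_le (M : R) f y :
  (\forall n \near U, forall x, normc (f n x) <= M) -> normc (ev y f) <= M.
Proof.
move=> fM; apply/ler_addgt0Pr => e e0.
have [n [fn [x [fx _ _]]]] :=
  filter_ex (filterI fM (ev_approx y f f f e0)).
rewrite -[ev y f]subr0 (le_trans (normc_triangle _ (f n x) _))// subr0.
by rewrite addrC lerD// ltW// normc_distC.
Qed.

(** At a common approximating point x, [h n x] is close to [ev y h] and, by continuity, to [op] of
    the other two values. The algebraic laws of [ev] are instances. *)
Lemma ev_calculus (op : R[i]^o * R[i]^o -> R[i]^o) f g h y :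
  {for (ev y f : R[i]^o, ev y g : R[i]^o), continuous op} ->
  (\forall n \near U, forall x, h n x = op (f n x, g n x)) ->
  ev y h = op (ev y f, ev y g).
Proof.
move=> cop hE; apply/eqP; rewrite -subr_eq0; apply/eqP/normc_eq0P => e e0.
have e20 : 0 < e / 2 by rewrite divr_gt0.
have [[A B] /= [nA nB] AB] := (normc_cvgP _ _ _).1 cop _ e20.
have [a a0 aA] := (nbhs_normcP _ _).1 nA.
have [b b0 bB] := (nbhs_normcP _ _).1 nB.
pose d := Order.min (Order.min a b) (e / 2).
have d0 : 0 < d by rewrite !lt_min a0 b0.
have [n [hn [x [fx gx hx]]]] := filter_ex (filterI hE (ev_approx y f g h d0)).
rewrite (le_lt_trans (normc_triangle _ (h n x) _))// [ltRHS]splitr ltrD//.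
  by rewrite normc_distC (lt_le_trans hx)// !ge_min lexx orbT.
rewrite hn normc_distC; apply: (AB (f n x : R[i]^o, g n x : R[i]^o)).
split=> /=.
  by apply: aA; rewrite normc_distC (lt_le_trans fx)// !ge_min lexx.
by apply: bB; rewrite normc_distC (lt_le_trans gx)// !ge_min lexx orbT.
Qed.

Lemma ev_calculus1 (op : R[i]^o -> R[i]^o) f h y :
  {for (ev y f : R[i]^o), continuous op} ->
  (forall n x, h n x = op (f n x)) -> ev y h = op (ev y f).
Proof.
move=> cop hE; apply: (@ev_calculus (op \o fst) f f); last exact: filterE.
move=> A /cop opA; exists (op @^-1` A, setT); last by move=> [z w] [].
by split=> //; exact: filterT.
Qed.

(** By this, characters, though defined on sequences, factor through the ultrapower. *)
Lemma ev_eqv f g y : ultra_eqv U f g -> ev y f = ev y g.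
Proof.
move=> /(ultra_eqvP UU) fg; apply/eqP; rewrite -subr_eq0.
apply/eqP/normc_eq0P => e e0.
have e30 : 0 < e / 3 by rewrite divr_gt0.
have [n [fgn [x [fx gx _]]]] :=
  filter_ex (filterI (fg _ e30) (ev_approx y f g g e30)).
rewrite normc_distC in fx.
have := normc_triangle (ev y f) (f n x) (ev y g).
have := normc_triangle (f n x) (g n x) (ev y g).
by have := fgn x; lra.
Qed.

Lemma ev_ext f g y : (forall n x, f n x = g n x) -> ev y f = ev y g.
Proof.
move=> fg; apply: ev_eqv; apply/(ultra_eqvP UU) => e e0.
by apply: filterE => n x; rewrite fg subrr normc0 ltW.
Qed.

Lemma ev_one y : ev y bseq_one = 1.
Proof.
apply: (@ev_calculus (cst 1) bseq_one bseq_one); first exact: cvg_cst.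
exact: filterE.
Qed.

Lemma ev_add f g y : ev y (bseq_add f g) = ev y f + ev y g.
Proof.
apply: (@ev_calculus (fun p => p.1 + p.2)); first exact: add_continuous.
exact: filterE.
Qed.

Lemma ev_mul f g y : ev y (bseq_mul f g) = ev y f * ev y g.
Proof.
apply: (@ev_calculus (fun p => p.1 * p.2)); first exact: mul_continuous.
exact: filterE.
Qed.

Lemma ev_scale c f y : ev y (bseq_scale c f) = c * ev y f.
Proof.
apply: (@ev_calculus1 ( *%R c) f) => //.
have FF := nbhs_filter (ev y f : R[i]^o).
exact: (cvgM (@cvg_cst _ _ _ _ FF) cvg_id).
Qed.

Lemma ev_star f y : ev y (bseq_star f) = conjc (ev y f).
Proof.
by apply: (@ev_calculus1 (fun a => conjc a) f) => //; exact: conjc_cts.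
Qed.

Section Map.
Variable op : R[i]^o -> R[i]^o.
Hypothesis op_cts : continuous op.
Hypothesis op_bd :
  forall M : R, exists N, forall a, normc a <= M -> normc (op a) <= N.

Lemma bseq_map_cts f n : continuous (fun x => op (f n x) : R[i]^o).
Proof.
by move=> x; exact: (cvg_comp _ _ (@cts_fun _ _ (f n) x) (@op_cts _)).
Qed.

Lemma bseq_map_bd f :
  exists M : R, forall n x, normc (mkcts (@bseq_map_cts f n) x) <= M.
Proof.
have [M fM] := bseq_bounded f; have [N opN] := op_bd M.
by exists N => n x; exact: opN.
Qed.

Definition bseq_map f : bseq_C R X := BseqC (@bseq_map_bd f).

Lemma ev_map f y : ev y (bseq_map f) = op (ev y f).
Proof.
by apply: (@ev_calculus1 op f) => //; exact: op_cts.
Qed.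

End Map.

(** The limits along [U] of the evaluations at [s n] form a character, with [s n] itself as the
    common point. *)
Lemma ultraspec_point (s : nat -> X) : exists y : Y, forall f (e : R), 0 < e ->
  \forall n \near U, normc (f n (s n) - ev y f) < e.
Proof.
have lim f : exists l, forall e : R, 0 < e ->
    \forall n \near U, normc (f n (s n) - l) < e.
  by have [M fM] := bseq_bounded f; apply: (ultra_normc_lim UU (M := M)).
pose l f := projT1 (cid (lim f)).
have lE f (e : R) : 0 < e -> \forall n \near U, normc (f n (s n) - l f) < e.
  exact: (projT2 (cid (lim f))).
have lP f g h (e : R) : 0 < e -> \forall n \near U, exists x,
    [/\ normc (f n x - l f) < e, normc (g n x - l g) < e &
        normc (h n x - l h) < e].
  move=> e0; apply: filterS3 (lE f _ e0) (lE g _ e0) (lE h _ e0) => n.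
  by exists (s n).
by exists (@Ultraspec UU l lP).
Qed.

(** If the bound failed for U-many n, points [s n] of failure would define a character whose value
    at [f] has norm at least [b]. This is a converse of [ev_le], up to a strict gap. *)
Lemma ev_norm_near f (a b : R) : (forall y, normc (ev y f) <= a) -> a < b ->
  \forall n \near U, forall x, normc (f n x) <= b.
Proof.
move=> fa ab.
have [//|nV] := in_ultra_setVsetC [set n | forall x, normc (f n x) <= b] UU.
exfalso.
have nV' : \forall n \near U, exists x, b < normc (f n x).
  by apply: filterS nV => n /existsNP[x /negP]; rewrite -ltNge; exists x.
have [_ [x0 _]] := filter_ex nV'.
(* [x0] is a filler for those n at which the bound holds. *)
have /choice[s sP] n : exists x, (exists x, b < normc (f n x)) ->
    b < normc (f n x).
  by have [[x h]|h] := pselect (exists x, b < normc (f n x));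
    [exists x|exists x0].
have [y ys] := ultraspec_point s.
have ba0 : 0 < b - a by rewrite subr_gt0.
have [n [/sP bn yn]] := filter_ex (filterI nV' (ys f _ ba0)).
have := normc_triangle (f n (s n)) (ev y f) 0.
by rewrite !subr0; have := fa y; lra.
Qed.

End Ultraspectrum.

Section Bump.
Context {R : realType} {X : topologicalType} {U : set_system nat}.
Context {UU : UltraFilter U}.
Implicit Types (f g : bseq_C R X) (y : ultraspec (R := R) (X := X) UU).

Lemma bump_bd (a : R[i]) (e : R) :
  forall M : R, exists N, forall b, normc b <= M -> normc (bump a e b) <= N.
Proof.
move=> M; exists 1 => b _; have [t /andP[t0 t1] ->] := bump_unit a e b.
by rewrite normc_real ger0_norm.
Qed.

Definition bseq_bump a e f := bseq_map (@bump_cts R a e) (@bump_bd a e) f.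

Lemma ev_bump a e f y : ev y (bseq_bump a e f) = bump a e (ev y f).
Proof. exact: ev_map. Qed.

End Bump.

(** * Topology of the spectrum *)

Section SpectrumTopology.
Context {R : realType} {X : topologicalType} {U : set_system nat}.
Variable UU : UltraFilter U.
Local Notation Y := (ultraspec (R := R) (X := X) UU).
Implicit Types (f g h : bseq_C R X) (y z : Y).

Definition spec_nbhs y : set_system Y := [set A | exists f (e : R),
  0 < e /\ forall z, normc (ev z f - ev y f) < e -> A z].

HB.instance Definition _ := hasNbhs.Build Y spec_nbhs.

(** A basic neighbourhood is given by a single sequence, so two must be merged: the product of the
    two bumps is 1 at [y] and 0 once either condition fails. *)
Lemma spec_nbhsI y (A B : set Y) : spec_nbhs y A -> spec_nbhs y B ->
  spec_nbhs y (A `&` B).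
Proof.
move=> [f [d [d0 fA]]] [g [e [e0 gB]]].
pose p := bseq_mul (bseq_bump (ev y f) d f) (bseq_bump (ev y g) e g).
exists p, 1; split=> // z.
rewrite /p !ev_mul !ev_bump.
rewrite (@bump1 _ (ev y f) d (ev y f)) ?subrr ?normc0 ?divr_gt0//.
rewrite (@bump1 _ (ev y g) e (ev y g)) ?subrr ?normc0 ?divr_gt0// mulr1.
move=> z1; split.
  apply: fA; rewrite ltNge; apply/negP => /(bump0 d0) b0.
  by move: z1; rewrite b0 mul0r sub0r normcN normc1 ltxx.
apply: gB; rewrite ltNge; apply/negP => /(bump0 e0) b0.
by move: z1; rewrite b0 mulr0 sub0r normcN normc1 ltxx.
Qed.

Lemma spec_nbhs_filter y : ProperFilter (spec_nbhs y).
Proof.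
split; first by move=> [f [e [e0 /(_ y)]]]; rewrite subrr normc0; apply.
split; first by exists bseq_one, 1.
- by move=> A B; exact: spec_nbhsI.
- by move=> A B AB [f [e [e0 fA]]]; exists f, e; split=> // z /fA /AB.
Qed.

Lemma spec_nbhs_singleton y (A : set Y) : spec_nbhs y A -> A y.
Proof. by move=> [f [e [e0]]]; apply; rewrite subrr normc0. Qed.

Lemma spec_nbhs_nbhs y (A : set Y) :
  spec_nbhs y A -> spec_nbhs y (spec_nbhs^~ A).
Proof.
move=> [f [e [e0 fA]]]; exists f, e; split=> // z ze.
exists f, (e - normc (ev z f - ev y f)).
split=> [|w wz]; first by rewrite subr_gt0.
by apply: fA; have := normc_triangle (ev w f) (ev z f) (ev y f); lra.
Qed.

HB.instance Definition _ := Nbhs_isNbhsTopological.Build Y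
  spec_nbhs_filter spec_nbhs_singleton spec_nbhs_nbhs.

Lemma ev_near f y (e : R) : 0 < e ->
  \forall z \near y, normc (ev z f - ev y f) < e.
Proof. by move=> e0; exists f, e; split. Qed.

Lemma ev_cts f : continuous (fun y => ev y f : R[i]^o).
Proof.
move=> y; apply/(normc_cvgP (nbhs_filter y)) => e e0.
by apply: filterS (ev_near f y e0) => z; rewrite normc_distC.
Qed.

Lemma ultraspec_hausdorff : hausdorff_space Y.
Proof.
move=> y z yz; apply: ultraspec_ext => f; apply/eqP; rewrite -subr_eq0.
apply/eqP/normc_eq0P => e e0; have e20 : 0 < e / 2 by rewrite divr_gt0.
have [w [wy wz]] := yz _ _ (ev_near f y e20) (ev_near f z e20).
move: wy; rewrite /= normc_distC => wy.
by have := normc_triangle (ev y f) (ev w f) (ev z f); move: wz => /=; lra.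
Qed.

Lemma ev_bd f : exists M : R, forall y, normc (ev y f) <= M.
Proof.
have [M fM] := bseq_bounded f; exists M => y.
by apply: ev_le; exact: filterE.
Qed.

(** An ultrafilter [V] converges to the limit of the evaluations along it. That limit is a
    character: at any three sequences some z is close to it, and z is approximated by points of
    [X]. *)
Lemma ultraspec_compact : compact [set: Y].
Proof.
rewrite compact_ultra => V UV _.
have FV : ProperFilter V by exact: ultra_proper.
have lim f : exists l, forall e : R, 0 < e ->
    \forall y \near V, normc (ev y f - l) < e.
  by have [M fM] := ev_bd f; apply: (ultra_normc_lim UV (M := M)).
have [l lE] := choice lim.
have lP f g h (e : R) : 0 < e -> \forall n \near U, exists x,
    [/\ normc (f n x - l f) < e, normc (g n x - l g) < e &
        normc (h n x - l h) < e].
  move=> e0; have e20 : 0 < e / 2 by rewrite divr_gt0.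
  have [z [fz [gz hz]]] :=
    filter_ex (filterI (lE f _ e20) (filterI (lE g _ e20) (lE h _ e20))).
  apply: filterS (ev_approx z f g h e20) => n [x [fx gx hx]]; exists x.
  by split; [have := normc_triangle (f n x) (ev z f) (l f)
    |have := normc_triangle (g n x) (ev z g) (l g)
    |have := normc_triangle (h n x) (ev z h) (l h)]; move: fz gz hz => /=; lra.
exists (@Ultraspec _ _ _ UU l lP); split=> // A [f [e [e0 fA]]].
by apply: filterS (lE f _ e0) => z; exact: fA.
Qed.

Section Shift.
Variable s : continuousType X X.

Lemma shift_approx y f g h (e : R) : 0 < e -> \forall n \near U, exists x,
    [/\ normc (f n x - ev y (bseq_sigma s f)) < e,
        normc (g n x - ev y (bseq_sigma s g)) < e &
        normc (h n x - ev y (bseq_sigma s h)) < e].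
Proof.
have FU : Filter U by typeclasses eauto.
move=> e0; apply: filterS (ev_approx y (bseq_sigma s f) (bseq_sigma s g)
  (bseq_sigma s h) e0) => n [x [fx gx hx]].
by exists (s x).
Qed.

Definition shift_fun y : Y := Ultraspec UU (@shift_approx y).

Lemma shift_cts : continuous shift_fun.
Proof.
move=> y A [f [e [e0 fA]]]; exists (bseq_sigma s f), e; split=> // z zy.
exact: fA.
Qed.

Definition shift : continuousType Y Y := mkcts shift_cts.

End Shift.

Lemma shiftK (s t : continuousType X X) :
  cancel s t -> cancel (shift s) (shift t).
Proof.
move=> st y; apply: ultraspec_ext => f.
apply: (@ev_ext _ _ _ UU (bseq_sigma s (bseq_sigma t f)) f) => n x /=.
by rewrite st.
Qed.

Lemma shift_homeomorphism (s : continuousType X X) :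
  homeomorphism s -> homeomorphism (shift s).
Proof.
by move=> [t [st ts]]; exists (shift t); split; exact: shiftK.
Qed.

(* Merging two local approximations along a bump function: where the bump is
   0 the old one is kept, elsewhere the result is a convex combination of two
   good approximations. *)
Lemma ev_dense (g : C R Y) (e : R) : 0 < e ->
  exists f, forall y, normc (ev y f - g y) <= e.
Proof.
move=> e0.
pose good (A : set Y) := exists f, forall y, A y -> normc (ev y f - g y) <= e.
suff : good setT by move=> [f fg]; exists f => y; exact: fg.
have : forall B, good B -> good (setT `|` B); last first.
  by move=> /(_ set0); rewrite setU0; apply; exists bseq_one.
(* Goodness is not visibly stable under unions, so the ideal consists of the sets whose union with
   every good set is good. *)
apply: (@compact_ideal Y [set A | forall B, good B -> good (A `|` B)]) => //=.
- exact: ultraspec_compact.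
- by move=> B; rewrite set0U.
- move=> A B AB BI D /BI[f fg]; exists f => y [/AB By|Dy]; apply: fg;
    by [left|right].
- by move=> A B AI BI D /BI/AI; rewrite setUA.
move=> y.
have [f [d [d0 fd]]] : \forall z \near y, normc (g y - g z) < e.
  have /(normc_cvgP (nbhs_filter y)) := @cts_fun _ _ g y; exact.
have d20 : 0 < d / 2 by rewrite divr_gt0.
(* On this half-radius ball the bump is 1 and only the constant [g y] counts; wherever the bump is
   nonzero, [g y] is still close to [g z]. *)
exists [set z | normc (ev z f - ev y f) < d / 2]; first exact: ev_near.
move=> B [h hB].
pose b := bseq_bump (ev y f) d f.
exists (bseq_add (bseq_scale (g y) b)
  (bseq_mul (bseq_add bseq_one (bseq_scale (-1) b)) h)) => z Bz.
rewrite ev_add ev_scale ev_mul ev_add ev_one ev_scale ev_bump.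
have [zd|dz] := ltP (normc (ev z f - ev y f)) d; last first.
  rewrite (bump0 d0)// mulr0 add0r mulr0 addr0 mul1r; apply: hB.
  by case: Bz => // /=; lra.
have gz := fd _ zd.
have [z2|z2] := ltP (normc (ev z f - ev y f)) (d / 2).
  by rewrite (bump1 d0)// !mulr1 subrr mul0r addr0 ltW.
have hz : normc (ev z h - g z) <= e by apply: hB; case: Bz => //=; lra.
have [t /andP[t0 t1] ->] := bump_unit (ev y f) d (ev z f).
have -> : g y * t%:C + (1 + -1 * t%:C) * ev z h - g z =
    t%:C * (g y - g z) + (1 - t)%:C * (ev z h - g z).
  by rewrite rmorphB/= rmorph1; ring.
rewrite (le_trans (le_normcD _ _))// !normcM !normc_real !ger0_norm ?subr_ge0//.
have -> : e = t * e + (1 - t) * e by ring.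
by rewrite lerD// ler_wpM2l ?subr_ge0// ltW.
Qed.

End SpectrumTopology.

(** If [U] contained the singleton of m, it would contain the principal ultrafilter at m and equal
    it by maximality. So points can be removed one at a time. *)
Lemma nonprincipal_near_ge (U : set_system nat) (UU : UltraFilter U) m :
  nonprincipal U -> \forall n \near U, (m <= n)%N.
Proof.
have FU : Filter U by typeclasses eauto.
move=> nU; elim: m => [|m IH]; first exact: filterE.
have : U (~` [set m]).
  have [Um|//] := in_ultra_setVsetC [set m] UU.
  have PU : ProperFilter U by exact: ultra_proper.
  case: (nU m); apply: (@max_filter _ _ (principal_filter_ultra m)).
  by move=> A /principal_filterP Am; apply: filterS Um => _ ->.
apply: filterS2 IH => n mn /= nm.
by rewrite ltn_neqAle mn andbT; apply/eqP => mE; apply: nm.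
Qed.

(** * The Gelfand isomorphism *)

Section Isomorphism.
Context {R : realType} {X : topologicalType} {U : set_system nat}.
Variables (UU : UltraFilter U) (s : continuousType X X).
Hypothesis nU : nonprincipal U.
Local Notation Y := (ultraspec (R := R) (X := X) UU).
Implicit Types (f g h : bseq_C R X) (y z : Y).

Lemma bseq_subE f g n x :
  bseq_add f (bseq_scale (-1) g) n x = f n x - g n x.
Proof. by rewrite -(mulN1r (g n x : R[i])). Qed.

Lemma ev_dist_le (M : R) f g y :
  (\forall n \near U, forall x, normc (f n x - g n x) <= M) ->
  normc (ev y f - ev y g) <= M.
Proof.
have FU : Filter U by typeclasses eauto.
move=> fg; rewrite -mulN1r -ev_scale -ev_add; apply: ev_le.
by apply: filterS fg => n fgn x; rewrite bseq_subE.
Qed.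

Lemma ev_dist_near f g (a b : R) :
  (forall y, normc (ev y f - ev y g) <= a) -> a < b ->
  \forall n \near U, forall x, normc (f n x - g n x) <= b.
Proof.
have FU : Filter U by typeclasses eauto.
move=> fg ab.
have : forall y, normc (ev y (bseq_add f (bseq_scale (-1) g))) <= a.
  by move=> y; rewrite ev_add ev_scale mulN1r.
move=> /ev_norm_near/(_ ab); apply: filterS => n fgn x.
by rewrite -bseq_subE.
Qed.

(* For U-many n, the n-th term of the diagonal sequence is that of an
   approximation whose index is as large as the distances in C(X) at place n
   permit. *)
Lemma ev_surj (g : C R Y) : exists f, forall y, ev y f = g y.
Proof.
have FU : ProperFilter U by exact: ultra_proper.
pose e_ (i : nat) : R := i.+1%:R^-1.
have e_gt0 i : 0 < e_ i by rewrite invr_gt0 ltr0n.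
have e_le i j : (i <= j)%N -> e_ j <= e_ i.
  by move=> ij; rewrite lef_pV2 ?posrE ?ltr0n// ler_nat ltnS.
have [f_ fP] := choice (fun i => ev_dense g (e_gt0 i)).
(* On the spectrum the two approximations differ by at most [e_ i + e_ j]; the factor 2 supplies the
   strict gap for [ev_dist_near]. *)
pose D i j n := forall x, normc (f_ i n x - f_ j n x) <= 2 * (e_ i + e_ j).
have DU i j : \forall n \near U, D i j n.
  apply: (@ev_dist_near _ _ (e_ i + e_ j)); last first.
    by have := e_gt0 i; have := e_gt0 j; lra.
  move=> y; rewrite (le_trans (normc_triangle _ (g y) _))// lerD//.
  by rewrite normc_distC.
(* The clause [m <= n] makes a largest m exist; m = 0 always qualifies. *)
pose Q n m := (m <= n)%N /\ forall i j : 'I_m.+1, D i j n.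
have QU m : \forall n \near U, Q n m.
  apply: filterI; first exact: nonprincipal_near_ge.
  by apply: filter_forall => i; apply: filter_forall => j.
have /choice[m_ mP] n : exists m, Q n m /\ forall i, Q n i -> (i <= m)%N.
  have Q0 : exists m, `[< Q n m >].
    exists 0; apply/asboolP; split=> // i j x.
    rewrite !ord1 subrr normc0 mulr_ge0// addr_ge0//; exact/ltW/e_gt0.
  have Qn m : `[< Q n m >] -> (m <= n)%N by move=> /asboolP[].
  case: (ex_maxnP Q0 Qn) => m /asboolP Qm mmax; exists m; split=> // i Qi.
  by apply: mmax; exact/asboolP.
have close n i x : (i <= m_ n)%N ->
    normc (f_ (m_ n) n x - f_ i n x) <= 4 * e_ i.
  move=> im; have [[_ nD] _] := mP n.
  apply: le_trans (nD ord_max (Ordinal (im : (i < (m_ n).+1)%N)) x) _ => /=.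
  by have := e_le _ _ im; lra.
have [M f0M] := bseq_bounded (f_ 0).
have hbd : exists M : R, forall n x, normc (f_ (m_ n) n x) <= M.
  exists (4 * e_ 0 + M) => n x; rewrite -[f_ (m_ n) n x]subr0.
  by rewrite (le_trans (normc_triangle _ (f_ 0 n x) _))// lerD ?subr0// close.
exists (BseqC hbd) => y; apply/eqP; rewrite -subr_eq0; apply/eqP.
(* Of the five parts, four bound the distance from the diagonal sequence to [f_ i], and one that
   from [f_ i] to [g]. *)
apply: normc_eq0P => e e0; have e50 : 0 < e / 5 by rewrite divr_gt0.
have [i /= ie] := filter_ex (near_infty_natSinv_lt (PosNum e50)).
have fi : normc (ev y (BseqC hbd) - ev y (f_ i)) <= 4 * e_ i.
  apply: ev_dist_le; apply: filterS (QU i) => n Qi x.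
  by apply: close; apply: (mP n).2.
have := normc_triangle (ev y (BseqC hbd)) (ev y (f_ i)) (g y).
by have := fP i y; move: ie; rewrite -/(e_ i); lra.
Qed.

Definition spec_eval f : C R Y := mkcts (@ev_cts _ _ _ UU f).

Definition gelfand (p : ultrapower_C (R := R) UU s) :
    C_struct R (shift (R := R) UU s) :=
  spec_eval (repr (p : {eq_quot ultra_equiv (R := R) (X := X) UU})).

Lemma gelfandE f : gelfand (ultra_class UU f) = spec_eval f.
Proof.
by apply/continuousEP => y; apply: ev_eqv; exact: ultra_eqv_repr.
Qed.

(** Bounds transfer both ways between the spectrum and U-many n. In particular, norms below
    [supnorm (spec_eval f) - e] for U-many n would bound every character value, hence their
    supremum. *)
Lemma spec_eval_norm f :
  (fun n => supnorm (f n)) @ U --> supnorm (spec_eval f).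
Proof.
have FU : ProperFilter U by exact: ultra_proper.
have [M fM] := ev_bd UU f; have [N fN] := bseq_bounded f.
have evle y : normc (ev y f) <= supnorm (spec_eval f).
  exact: (@normc_le_supnorm _ _ (spec_eval f) M).
apply/cvgrPdist_le => e e0.
have upper : \forall n \near U, supnorm (f n) <= supnorm (spec_eval f) + e.
  have ae : supnorm (spec_eval f) < supnorm (spec_eval f) + e by rewrite ltrDl.
  apply: filterS (ev_norm_near evle ae) => n fn; apply: supnorm_le => //.
  by rewrite addr_ge0 ?supnorm_ge0// ltW.
have lower : \forall n \near U, supnorm (spec_eval f) - e <= supnorm (f n).
  have [//|nV] :=
    in_ultra_setVsetC [set n | supnorm (spec_eval f) - e <= supnorm (f n)] UU.
  have nV' : \forall n \near U, supnorm (f n) < supnorm (spec_eval f) - e.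
    by apply: filterS nV => n /= /negP; rewrite -ltNge.
  have [n fn] := filter_ex nV'.
  have ae0 := le_trans (supnorm_ge0 (f n)) (ltW fn).
  exfalso; have : supnorm (spec_eval f) <= supnorm (spec_eval f) - e.
    apply: supnorm_le => // y; apply: ev_le; apply: filterS nV' => k fk x.
    apply: le_trans (ltW fk).
    exact: (@normc_le_supnorm _ _ (f k) N).
  by lra.
apply: filterS2 upper lower => n; rewrite ler_norml => h1 h2.
by apply/andP; split; lra.
Qed.

Lemma gelfand_inj : injective gelfand.
Proof.
have FU : Filter U by typeclasses eauto.
move=> p q pq; rewrite -[p]reprK -[q]reprK.
apply/ultra_classP/(ultra_eqvP UU) => e e0.
apply: (@ev_dist_near _ _ 0) => // y.
have /continuousEP/(_ y) : gelfand p = gelfand q by [].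
by move=> pqy; rewrite -[ev y (repr p)]/(gelfand p y) pqy subrr normc0.
Qed.

Lemma ultrapower_gelfand :
  Lisomorphic (ultrapower_C (R := R) UU s) (C_struct R (shift (R := R) UU s)).
Proof.
have classK (p : ultrapower_C (R := R) UU s) : ultra_class UU (repr p) = p.
  exact: reprK.
exists gelfand; split; [|split; [|split; [|split; [|split; [|split; [|split]]]]]].
- have gsurj (g : C R Y) : exists p, gelfand p = g.
    have [f fg] := ev_surj g; exists (ultra_class UU f).
    by rewrite gelfandE; apply/continuousEP.
  have [G GK] := choice gsurj.
  by exists G => // p; apply: gelfand_inj; rewrite GK.
- by rewrite gelfandE; apply/continuousEP => y; exact: ev_one.
- move=> p q; rewrite -(classK p) -(classK q) /= ultra_addE !gelfandE.
  by apply/continuousEP => y; exact: ev_add.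
- move=> p q; rewrite -(classK p) -(classK q) /= ultra_mulE !gelfandE.
  by apply/continuousEP => y; exact: ev_mul.
- move=> c p; rewrite -(classK p) /= ultra_scaleE !gelfandE.
  by apply/continuousEP => y; exact: ev_scale.
- move=> p; rewrite -(classK p) /= ultra_starE !gelfandE.
  by apply/continuousEP => y; exact: ev_star.
- by move=> p; symmetry; apply: cvg_lim => //; exact: spec_eval_norm.
- move=> p; rewrite -(classK p) /= ultra_sigmaE !gelfandE.
  by apply/continuousEP => y.
Qed.

End Isomorphism.

(** * Paths in spirals *)

Section SpiralPaths.
Variables (c : attachment) (N : nat) (u : nat -> Wpt).
Hypothesis uW : forall i, W N (u i).
Hypothesis uR : forall i, W_rel c N (u i) (u i.+1).
Let a i := (u i).2.1.
Let k i := (u i).2.2.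

Lemma path_word i j : (u i).1 = (u j).1.
Proof.
have u0 i' : (u i').1 = (u 0).1.
  by elim: i' => // i' <-; have [->] := uR i'.
by rewrite u0 (u0 j).
Qed.

Lemma path_spiral i : spiral N (a i, k i).
Proof. by have [_] := uW i; rewrite /a /k; case: (u i).2. Qed.

Lemma path_rel i : spiral_rel c N (a i, k i) (a i.+1, k i.+1).
Proof. by have [_] := uR i; rewrite /a /k; case: (u i).2; case: (u i.+1).2. Qed.

(** No edge enters the left arm from outside; dually, in [path_r_next], none leaves the right
    arm. *)
Lemma path_l_prev i d : a (i + d) = arm_l -> a i = arm_l.
Proof.
elim: d => [|d IH]; first by rewrite addn0.
rewrite addnS => al; apply: IH.
have := path_rel (i + d); rewrite al /spiral_rel /=.
by case: (a (i + d)).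
Qed.

Lemma path_r_next i d : a i = arm_r -> a (i + d) = arm_r.
Proof.
move=> ar; elim: d => [|d IH]; first by rewrite addn0.
rewrite addnS; have := path_rel (i + d); rewrite IH /spiral_rel /=.
by case: (a (i + d).+1).
Qed.

Lemma path_loop_step i : a i = a i.+1 -> a i <> arm_m ->
  k i.+1 = ((k i + 1) %% N`!%:Z)%Z.
Proof.
have F0 := fact_gt0 N; have := path_rel i; have := path_spiral i.
have := path_spiral i.+1; rewrite /spiral /spiral_rel /=.
move=> sp' sp r e nm; rewrite -e in sp' r.
have [k1|[k1 k2]] : k i.+1 = k i + 1 \/ k i = N`!%:Z - 1 /\ k i.+1 = 0.
- by move: r nm; case: (a i).
- by rewrite modz_small -?k1//; move: sp' nm; case: (a i).
- by rewrite k2 k1 subrK modzz.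
Qed.

Lemma path_loop i d : (forall d', (d' <= d)%N -> a (i + d') = a i) ->
  a i <> arm_m -> k (i + d) = ((k i + d%:Z) %% N`!%:Z)%Z.
Proof.
have F0 := fact_gt0 N.
elim: d => [|d IH] ad nm.
  rewrite addn0 addr0 modz_small//.
  by have := path_spiral i; rewrite /spiral /=; move: nm; case: (a i).
have IHd : k (i + d) = ((k i + d%:Z) %% N`!%:Z)%Z.
  by apply: IH => // d' d'd; apply: ad; exact: leqW.
rewrite addnS path_loop_step ?IHd ?modzDml//.
- by rewrite -addrA -PoszD addn1.
- by rewrite -addnS !ad.
- by rewrite ad.
Qed.

Lemma path_period i : (forall d, (d <= N`!)%N -> a (i + d) = a i) ->
  a i <> arm_m -> u (i + N`!) = u i.
Proof.
move=> ad nm; have := path_loop ad nm; rewrite modzDr modz_small; last first.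
  by have := path_spiral i; rewrite /spiral /=; move: nm; case: (a i).
have := ad _ (leqnn _); have := path_word (i + N`!) i; rewrite /a /k.
by case: (u i) => ? [? ?]; case: (u (i + N`!)) => ? [? ?] /= -> -> ->.
Qed.

(** The position grows by 1 at each step inside the middle arm, which has only 2N - 1 points. *)
Lemma path_leave_m i : a i <> arm_l -> a (i + 2 * N) = arm_r.
Proof.
move=> nl; apply: contrapT => nr.
have am d : (d <= 2 * N)%N -> a (i + d) = arm_m.
  move=> dN; case E: (a (i + d)) => //.
    by case: nl; apply: path_l_prev E.
  by case: nr; rewrite -(subnKC dN) addnA; exact: path_r_next.
have kd d : (d <= 2 * N)%N -> k (i + d) = k i + d%:Z.
  elim: d => [|d IH] dN; first by rewrite addn0 addr0.
  have := path_rel (i + d); rewrite -addnS !am// ?(ltnW dN)// /spiral_rel /=.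
  by move=> ->; rewrite IH ?(ltnW dN)//; lia.
have := path_spiral i; have := path_spiral (i + 2 * N).
have := am 0%N (leq0n _); rewrite addn0 => ->.
by rewrite am// kd// /spiral /=; lia.
Qed.

(** A path still on the left arm after a full turn was on it throughout, hence has closed a loop.
    Otherwise it has left that arm, and 2N steps later it circles the right one for ever. *)
Lemma path_eventually_periodic i :
  u (i + N`!) = u i \/
  forall j, (i + N`! + 2 * N <= j)%N -> u (j + N`!) = u j.
Proof.
have [al|nl] := pselect (a (i + N`!) = arm_l); [left|right => j ij].
  have ai : a i = arm_l := path_l_prev al.
  apply: path_period; last by rewrite ai.
  move=> d dN; rewrite ai; apply: (@path_l_prev _ (N`! - d)).
  by rewrite -addnA subnKC.
have ar d : (i + N`! + 2 * N <= d)%N -> a d = arm_r.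
  by move=> dj; rewrite -(subnKC dj); exact/path_r_next/path_leave_m.
apply: path_period; last by rewrite ar.
by move=> d _; rewrite !ar// (leq_trans ij)// leq_addr.
Qed.

End SpiralPaths.

(** * Powers of two against periodicity *)

Definition power_of_two (n : nat) : bool := `[< exists j, n = (2 ^ j)%N >].

(** The sum lies strictly between two consecutive powers. *)
Lemma power_of_two_gap j p : (0 < p < 2 ^ j)%N -> ~~ power_of_two (2 ^ j + p).
Proof.
move=> /andP[p0 pj]; apply/asboolPn => -[i iE].
have ji : (j < i)%N by rewrite -(@ltn_exp2l 2)// -iE; lia.
have : (i < j.+1)%N by rewrite -(@ltn_exp2l 2)// -iE expnS; lia.
lia.
Qed.

Lemma spiral_path_not_power (c : attachment) (N : nat) (u : nat -> Wpt) :
  (forall i, W N (u i)) -> (forall i, W_rel c N (u i) (u i.+1)) ->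
  ~ (forall i j, u i = u j -> power_of_two i = power_of_two j).
Proof.
move=> uW uR upow; set P := N`!; have P0 : (0 < P)%N by exact: fact_gt0.
(* With this j, [2 ^ j] exceeds the period and [2 ^ j.+1] lies beyond the waiting time counted from
   [2 ^ j]. One of these two powers is shifted by the period to a non-power. *)
pose j := (P + 2 * N)%N.
have jP : (P + 2 * N < 2 ^ j)%N by exact: ltn_expl.
have pow i : power_of_two (2 ^ i) by apply/asboolP; exists i.
have [/upow|/(_ (2 ^ j.+1)%N)] := path_eventually_periodic uW uR (2 ^ j)%N.
  by rewrite pow => h; have := @power_of_two_gap j P; rewrite h; lia.
have jS : (2 ^ j.+1 = 2 ^ j + 2 ^ j)%N by rewrite expnS mul2n addnn.
rewrite -/P => /(_ _)/upow; rewrite pow => h.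
have := @power_of_two_gap j.+1 P; rewrite h; last by lia.
by lia.
Qed.

(** * Locally constant maps on the spectrum *)

Lemma locally_constant_cts (T Z : topologicalType) (f : T -> Z) :
  (forall x : T, \forall y \near x, f y = f x) -> continuous f.
Proof.
by move=> fl x A /nbhs_singleton Afx; apply: filterS (fl x) => y /= ->.
Qed.

Lemma discrete_locally_constant (T : topologicalType)
    (D : discreteTopologicalType) (f : T -> D) (x : T) :
  continuous f -> \forall y \near x, f y = f x.
Proof.
move=> cf; apply: (cf x [set d | d = f x]).
by rewrite nbhs_principalE; exact/principal_filterP.
Qed.

Section NatValued.
Context {R : realType} {X : topologicalType} {U : set_system nat}.
Variable UU : UltraFilter U.
Local Notation Y := (ultraspec (R := R) (X := X) UU).
Implicit Types (y z : Y).

(** Locally constant maps with finitely many values, coded by naturals so as to become bounded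
    sequences in C(X). *)
Record natseq := NatSeq {
  natseq_fun :> nat -> X -> nat ;
  natseq_loc : forall n (x : X),
    \forall x' \near x, natseq_fun n x' = natseq_fun n x ;
  natseq_bd : exists K, forall n x, (natseq_fun n x <= K)%N
}.
Implicit Types a b : natseq.

Lemma natseq_cts a n : continuous (fun x => (a n x)%:R : R[i]^o).
Proof.
apply: locally_constant_cts => x.
by apply: filterS (natseq_loc a n x) => x' ->.
Qed.

Lemma normc_nat m : normc (m%:R : R[i]) = m%:R.
Proof. by rewrite -(rmorph_nat (@real_complex R)) normc_real ger0_norm. Qed.

Lemma natseq_bseq_bd a :
  exists M : R, forall n x, normc (mkcts (@natseq_cts a n) x) <= M.
Proof.
have [K aK] := natseq_bd a; exists K%:R => n x.
by rewrite [mkcts _ _]/= normc_nat ler_nat.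
Qed.

Definition natseq_bseq a : bseq_C R X := BseqC (@natseq_bseq_bd a).

Lemma normc_nat_lt1 m n (v : R[i]) : normc (m%:R - v) < 1 / 2 ->
  normc (n%:R - v) < 1 / 2 -> m = n.
Proof.
wlog mn : m n / (m <= n)%N.
  move=> H mv nv; case: (leqP m n) => [|/ltnW] h; first exact: H.
  by symmetry; exact: H.
move=> mv nv; have := normc_triangle n%:R v m%:R.
rewrite (normc_distC v) -natrB// normc_nat => h.
have : ((n - m)%:R : R) < 1 by lra.
by rewrite -[ltRHS]mulr1n ltr_nat; lia.
Qed.

(** The value is approximated by naturals, and two naturals within 1/2 of it coincide. *)
Lemma ev_natseq a y : exists m, ev y (natseq_bseq a) = m%:R.
Proof.
have FU : ProperFilter U by exact: ultra_proper.
set v := ev y _.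
have near_v (e : R) : 0 < e -> exists m, normc (m%:R - v) < e.
  move=> e0; have [n [x [h _ _]]] := filter_ex
    (ev_approx y (natseq_bseq a) (natseq_bseq a) (natseq_bseq a) e0).
  by exists (a n x).
have [m mv] := near_v (1 / 2) ltac:(lra).
exists m; apply/eqP; rewrite -subr_eq0; apply/eqP/normc_eq0P => e e0.
have [|m' m'v] := near_v (Order.min e (1 / 2)); first by rewrite lt_min e0; lra.
move: m'v; rewrite lt_min => /andP[m'e m'v].
by rewrite (normc_nat_lt1 mv m'v) normc_distC.
Qed.

Definition natval a y : nat := sval (cid (ev_natseq a y)).

Lemma natvalE a y : ev y (natseq_bseq a) = (natval a y)%:R.
Proof. exact: (svalP (cid (ev_natseq a y))). Qed.

(** For naturals, approximation within 1/2 is equality, so relations between two codes at a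
    character can be read off at a point of [X]. *)
Lemma natval_transfer a b y :
  \forall n \near U, exists x, a n x = natval a y /\ b n x = natval b y.
Proof.
have FU : ProperFilter U by exact: ultra_proper.
have e0 : (0 : R) < 1 / 2 by lra.
apply: filterS (ev_approx y (natseq_bseq a) (natseq_bseq b) (natseq_bseq b) e0).
move=> n [x [ax bx _]]; exists x; rewrite !natvalE in ax bx.
split; [apply: normc_nat_lt1 ax _|apply: normc_nat_lt1 bx _] => //;
  by rewrite subrr normc0.
Qed.

Lemma natval_loc a y : \forall z \near y, natval a z = natval a y.
Proof.
have e0 : (0 : R) < 1 / 2 by lra.
apply: filterS (ev_near (natseq_bseq a) y e0) => z; rewrite !natvalE => h.
by apply: normc_nat_lt1 h _ => //; rewrite subrr normc0.
Qed.

Lemma natval_point a y (x : nat -> X) :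
  (forall (f : bseq_C R X) (e : R), 0 < e ->
    \forall n \near U, normc (f n (x n) - ev y f) < e) ->
  \forall n \near U, natval a y = a n (x n).
Proof.
have FU : ProperFilter U by exact: ultra_proper.
have e0 : (0 : R) < 1 / 2 by lra.
move=> /(_ (natseq_bseq a) _ e0); apply: filterS => n; rewrite natvalE => h.
by symmetry; apply: normc_nat_lt1 h _ => //; rewrite subrr normc0.
Qed.

Variable s : continuousType X X.

Lemma natseq_shift_loc a n (x : X) :
  \forall x' \near x, a n (s x') = a n (s x).
Proof. exact: (@cts_fun _ _ s x _ (natseq_loc a n (s x))). Qed.

Lemma natseq_shift_bd a : exists K, forall n x, (a n (s x) <= K)%N.
Proof. by have [K aK] := natseq_bd a; exists K. Qed.

Definition natseq_shift a :=
  NatSeq (@natseq_shift_loc a) (@natseq_shift_bd a).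

Lemma natval_shift a y : natval (natseq_shift a) y = natval a (shift UU s y).
Proof.
have : ev y (natseq_bseq (natseq_shift a)) = ev (shift UU s y) (natseq_bseq a).
  exact: ev_ext.
by rewrite !natvalE => /eqP; rewrite eqr_nat => /eqP.
Qed.

End NatValued.

(** * Spirals with long middle arms *)

Lemma spiral_map_levels (c : attachment) (R : realType) (X : metricType R)
    (s : X -> X) n phi : (0 < n)%N -> lifting_property c s ->
  spiral_map c s n phi ->
  forall m, exists N psi, (m < N)%N /\ spiral_map c s N psi.
Proof.
move=> n0 lift sphi; elim=> [|m [N [psi [mN spsi]]]]; first by exists n, phi.
have [k [psi' [k1 spsi' _ _]]] :=
  (* Only the gain in level matters, so the diameter bound 1 is arbitrary. *)
  lift 1 N psi ltr01 (leq_ltn_trans (leq0n m) mN) spsi.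
by exists (N + k)%N, psi'; split=> //; lia.
Qed.

(** From the left end of the middle arm an orbit has no choice for the next N - 1 steps, so its
    position tells the time and [pat] can be read from it. *)
Lemma spiral_pattern (c : attachment) (X : topologicalType) (s : X -> X) N psi
    (pat : nat -> bool) : (0 < N)%N -> spiral_map c s N psi ->
  exists (b : X -> bool) (x : X),
    (forall x : X, \forall x' \near x, b x' = b x) /\
    forall i, (i < N)%N -> b (iter i s x) = pat i.
Proof.
move=> N0 [cpsi rpsi Rpsi].
pose u : Wpt := (nseq N L1, (arm_m, - N%:Z + 1)).
have [x _ xu] : range psi u.
  by rewrite rpsi; split=> /=; [rewrite size_nseq|rewrite /spiral /=; lia].
have orbit i : (i < N)%N -> (psi (iter i s x)).2 = (arm_m, - N%:Z + 1 + i%:Z).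
  elim: i => [|i IH] iN; first by rewrite /= xu addr0.
  have [_] := Rpsi (iter i s x); rewrite (IH (ltnW iN)) -iterS /spiral_rel /=.
  case: (psi _) => w [[]] q //=; first by move=> ->; congr pair; lia.
  by lia.
exists (fun x' => pat (absz ((psi x').2.2 + N%:Z - 1)%R)), x; split=> [x'|i iN].
  by apply: filterS (discrete_locally_constant x' cpsi) => x'' ->.
by rewrite orbit//=; congr pat; lia.
Qed.

(** * Failure of the lifting property *)

Section NoLifting.
Context {R : realType} {X : topologicalType} {U : set_system nat}.
Variables (UU : UltraFilter U) (s : continuousType X X).
Local Notation Y := (ultraspec (R := R) (X := X) UU).
Local Notation t := (shift (R := R) UU s).

Lemma natval_cts (a : natseq (X := X)) :
  continuous (natval a : Y -> nat).
Proof. by apply: locally_constant_cts => y; exact: natval_loc. Qed.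

Lemma natval_fibres (a : natseq (X := X)) :
  clopen_partition (fibre_partition (natval a : Y -> nat)).
Proof.
split=> [_ [_ [y _ <-] <-]| |].
- split; last by exists y.
  apply: preimage_clopen; last exact: natval_cts.
  by split; [exact: discrete_open|exact: discrete_closed].
- apply/seteqP; split=> // y _; exists (natval a @^-1` [set natval a y]) => //.
  by exists (natval a y) => //; exists y.
- by move=> _ _ [_ [y _ <-] <-] [_ [z _ <-] <-] [w [/= -> ->]].
Qed.

Lemma shift_point (x : nat -> X) (y : Y) i :
  (forall (f : bseq_C R X) (e : R), 0 < e ->
    \forall n \near U, normc (f n (x n) - ev y f) < e) ->
  forall (f : bseq_C R X) (e : R), 0 < e ->
    \forall n \near U, normc (f n (iter i s (x n)) - ev (iter i t y) f) < e.
Proof.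
by move=> xy; elim: i => [//|i IH] f e e0; exact: (IH (bseq_sigma s f)).
Qed.

Lemma spectrum_no_lifting (c : attachment) n0 (phi : X -> Wpt) :
  compact [set: X] -> nonprincipal U -> (0 < n0)%N -> spiral_map c s n0 phi ->
  (forall m, exists N psi, (m < N)%N /\ spiral_map c s N psi) ->
  ~ partition_lifting_property c t.
Proof.
move=> cX nU n00 [cphi rphi Rphi] levels lift.
have FU : ProperFilter U by exact: ultra_proper.
have /finite_seqP[w wE] : finite_set (range phi).
  exact: compact_discrete_range cX cphi.
have phiw x : phi x \in w.
  by have : range phi (phi x) := imageT phi x; rewrite wE.
(* [phi] has finite range; its values are replaced by their indices in [w]. *)
pose code v := index v w; pose dec := nth (([::], (arm_m, 0)) : Wpt) w.
have codeK x : dec (code (phi x)) = phi x by exact: nth_index.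
have code_bd x : (code (phi x) <= size w)%N by exact: index_size.
have phi_loc x : \forall x' \near x, phi x' = phi x.
  exact: discrete_locally_constant.
have P_loc (n : nat) x : \forall x' \near x, code (phi x') = code (phi x).
  by apply: filterS (phi_loc x) => x' ->.
have P_bd : exists K, forall (n : nat) x, (code (phi x) <= K)%N.
  by exists (size w).
pose P := NatSeq P_loc P_bd.
have /choice[b /choice[x bx]] m : exists (b : X -> bool) (x : X),
    (forall x : X, \forall x' \near x, b x' = b x) /\
    forall i, (i <= m)%N -> b (iter i s x) = power_of_two i.
  have [N [psi [mN spsi]]] := levels m.
  have [b [x [bl bx]]] :=
    spiral_pattern power_of_two (leq_ltn_trans (leq0n m) mN) spsi.
  by exists b, x; split=> // i im; apply: bx; exact: leq_ltn_trans im mN.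
(* One natural carries both data: its parity is [b], its half the code of [phi]. Hence the fibres of
   [A] refine those of [phiY]. *)
have A_loc n x0 : \forall x' \near x0,
    (b n x' + (code (phi x')).*2)%N = (b n x0 + (code (phi x0)).*2)%N.
  by apply: filterS2 (phi_loc x0) ((bx n).1 x0) => x' -> ->.
have A_bd : exists K, forall n x0, (b n x0 + (code (phi x0)).*2 <= K)%N.
  exists (1 + (size w).*2)%N => n x0; rewrite leq_add ?leq_b1//.
  by rewrite leq_double.
pose A := NatSeq A_loc A_bd.
pose phiY (y : Y) := dec (natval P y).
have phiYE (y : Y) : phiY y = dec (natval A y)./2.
  have [n [x0 [Px Ax]]] := filter_ex (natval_transfer P A y).
  by rewrite /phiY -Px -Ax /= half_bit_double.
have sphiY : spiral_map c t n0 phiY.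
  split.
  - apply: locally_constant_cts => y.
    by apply: filterS (natval_loc P y) => z; rewrite /phiY => ->.
  (* Values of [phiY] are values of [phi] by transfer; conversely a constant sequence of points [x0]
     gives a character at which [phiY] equals [phi x0]. *)
  - rewrite -rphi; apply/seteqP; split=> [_ [y _ <-]|_ [x0 _ <-]].
      have [n [x0 [Px _]]] := filter_ex (natval_transfer P P y).
      by exists x0 => //; rewrite /phiY -Px /= codeK.
    have [y yx] := ultraspec_point (R := R) UU (fun=> x0).
    have [n yP] := filter_ex (natval_point P yx).
    by exists y => //; rewrite /phiY yP /= codeK.
  - move=> y; have [n [x0 [Px Psx]]] :=
      filter_ex (natval_transfer P (natseq_shift s P) y).
    rewrite /phiY -natval_shift -Px -Psx /= !codeK.
    exact: Rphi.
have refA :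
    refines (fibre_partition (natval A : Y -> nat)) (fibre_partition phiY).
  move=> _ [_ [y _ <-] <-]; exists (phiY @^-1` [set phiY y]).
    by exists (phiY y) => //; exists y.
  by move=> z /= Az; rewrite !phiYE Az.
have [k [psi [_ [_ rpsi Rpsi] psiA _]]] :=
  lift n0 phiY _ n00 sphiY (natval_fibres A) refA.
have psi_natval (y z : Y) : psi y = psi z -> natval A y = natval A z.
  move=> yz.
  have [_ [_ [y' _ <-] <-] psiy] := psiA (psi @^-1` [set psi y])
    (ex_intro2 _ _ (psi y) (ex_intro2 _ _ y I erefl) erefl).
  by have /= -> := psiy y erefl; have /= -> := psiy z (esym yz).
have [y0 y0x] := ultraspec_point (R := R) UU x.
(* Non-principality gives [i <= n] for U-many n, where the pattern of [b n] along the orbit of [x n]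
   is already correct at i. *)
have odd_orbit i : odd (natval A (iter i t y0)) = power_of_two i.
  have [n [ni ->]] := filter_ex (filterI (nonprincipal_near_ge UU i nU)
    (natval_point A (@shift_point x y0 i y0x))).
  by rewrite /= oddD odd_double addbF oddb; exact: (bx n).2.
apply: (@spiral_path_not_power c (n0 + k) (fun i => psi (iter i t y0))).
- by move=> i; rewrite -rpsi; exists (iter i t y0).
- by move=> i; rewrite iterS.
- by move=> i j /psi_natval ij; rewrite -!odd_orbit ij.
Qed.

End NoLifting.

Theorem theorem3p3 (c : attachment) (R : realType) (X : metricType R)
    (s : continuousType X X) (U : set_system nat) (UU : UltraFilter U) :
  cantor_set X ->
  homeomorphism s ->
  lifting_property c s ->
  (exists (n : nat) (phi : X -> Wpt), (0 < n)%N /\ spiral_map c s n phi) ->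
  nonprincipal U ->
  exists (Y : topologicalType) (t : continuousType Y Y),
    [/\ compact [set: Y], hausdorff_space Y, homeomorphism t,
        Lisomorphic (ultrapower_C UU s) (C_struct R t) &
        ~ partition_lifting_property c t].
Proof.
move=> [[_ cX _ _] _] hs lift [n [phi [n0 sphi]]] nU.
exists (ultraspec (R := R) (X := X) UU), (shift (R := R) UU s); split.
- exact: ultraspec_compact.
- exact: ultraspec_hausdorff.
- exact: shift_homeomorphism.
- exact: ultrapower_gelfand.
- exact: (spectrum_no_lifting cX nU n0 sphi (spiral_map_levels n0 lift sphi)).
Qed.
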